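(* Let $\mathcal{B}$ be a real Banach space and let $\mathbb{P}$ be a kernel-based probability measure on $\mathcal{B}$ with mean $\mu\in\mathcal{B}$ and covariance kernel $\mathcal{K}:\mathcal{B}^*\times\mathcal{B}^*\to\mathbb{R}$. Let $u\in\mathrm{range}(\Gamma_{\mathcal{K}}^{\mu})$. Then there exist constants $C_1\ge0$ and $C_2\ge0$ such that for every $n\in\mathbb{N}$, all $L_1,\dots,L_n\in\mathcal{B}^*$ with $A_{\mathcal{K},\mathbf{L}_n}\ne0$ (where $\mathbf{L}_n:=(L_1,\dots,L_n)^T$), with $\mathbf{f}_n:=\mathbf{L}_nu$, and every $L\in\mathcal{B}^*$, $$|Lu-s_{\mathbf{L}_n,\mathbf{f}_n}(L)|\le C_1\,\sigma_{L|\mathbf{L}_n}+C_2\left|L\mu-\boldsymbol{\beta}_{\mathcal{K},\mathbf{L}_n}(L)^T\mathbf{L}_n\mu\right|.$$ (That is, $C_1,C_2$ are independent of $L$, $\mathbf{L}_n$ and $\mathbf{f}_n$.)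
   Context: Write $L\omega=\langle\omega,L\rangle$ for $\omega\in\mathcal{B}$, $L\in\mathcal{B}^*$ (the dual space), and $\mathbf{L}_n\omega:=(L_1\omega,\dots,L_n\omega)^T\in\mathbb{R}^n$. A Borel probability measure $\mathbb{P}$ on $\mathcal{B}$ is a kernel-based probability measure with mean $\mu\in\mathcal{B}$ and covariance kernel $\mathcal{K}:\mathcal{B}^*\times\mathcal{B}^*\to\mathbb{R}$ if, writing $S_L(\omega):=L\omega$, for every $n$ and all $L_1,\dots,L_n\in\mathcal{B}^*$ the random vector $(S_{L_1},\dots,S_{L_n})^T$ on $\mathcal{B}$ with its Borel $\sigma$-algebra and $\mathbb{P}$ has a (possibly degenerate) multivariate normal distribution with mean vector $\mathbf{L}_n\mu$ and covariance matrix $A_{\mathcal{K},\mathbf{L}_n}:=(\mathcal{K}(L_j,L_k))_{j,k=1}^{n}$. $\mathcal{H}_S$ is the closure of $\mathrm{span}\{S_L:L\in\mathcal{B}^*\}$ in $L_2(\mathcal{B},\mathbb{P})$, and $\Gamma_{\mathcal{K}}^{\mu}:\mathcal{H}_S\to\mathcal{B}$ is the bounded linear operator $\Gamma_{\mathcal{K}}^{\mu}(V):=\int_{\mathcal{B}}\omega V(\omega)\,\mathbb{P}(d\omega)$. Further, $A^{\dagger}$ is the (Moore-Penrose) pseudo-inverse of $A$, $\mathbf{b}_{\mathcal{K},\mathbf{L}_n}(L):=(\mathcal{K}(L,L_1),\dots,\mathcal{K}(L,L_n))^T$, $\boldsymbol{\beta}_{\mathcal{K},\mathbf{L}_n}(L):=A_{\mathcal{K},\mathbf{L}_n}^{\dagger}\mathbf{b}_{\mathcal{K},\mathbf{L}_n}(L)$,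 $$\sigma_{L|\mathbf{L}_n}:=\sqrt{\mathcal{K}(L,L)-\mathbf{b}_{\mathcal{K},\mathbf{L}_n}(L)^TA_{\mathcal{K},\mathbf{L}_n}^{\dagger}\mathbf{b}_{\mathcal{K},\mathbf{L}_n}(L)},$$ $$s_{\mathbf{L}_n,\mathbf{f}_n}(L):=L\mu+\mathbf{b}_{\mathcal{K},\mathbf{L}_n}(L)^TA_{\mathcal{K},\mathbf{L}_n}^{\dagger}(\mathbf{f}_n-\mathbf{L}_n\mu).$$ *)

(* Defs.v *)
From HB Require Import structures.
From mathcomp Require Import all_boot all_order all_algebra.
From mathcomp Require Import all_classical all_reals all_analysis.

Set Implicit Arguments.
Unset Strict Implicit.
Unset Printing Implicit Defensive.

Import Order.TTheory GRing.Theory Num.Theory.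
Import numFieldNormedType.Exports.

Local Open Scope classical_set_scope.
Local Open Scope ring_scope.

Section dual.
Context (R : realType) (B : normedModType R).

Record dual := Dual {
  dual_fun :> {linear B -> R^o} ;
  dual_continuous : continuous dual_fun }.

End dual.

(* [B] with its Borel sigma-algebra; convertible to [B]. *)
Notation borelType B := (g_sigma_algebraType (@open B)).

Section pseudo_inverse.
Context (R : realType) (m n : nat).
Implicit Types (A : 'M[R]_(m, n)) (X : 'M[R]_(n, m)).

Definition penrose A X :=
  [/\ A *m X *m A = A, X *m A *m X = X,
      (A *m X)^T = A *m X & (X *m A)^T = X *m A].

(* Moore-Penrose inverse: the default value 0 is never reached, and the
   choice is unique, see [penrose_pinv] and [penrose_unique] below. *)
Definition pinv A : 'M[R]_(n, m) := xget 0 [set X | penrose A X].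

Lemma penrose_unique A X Y : penrose A X -> penrose A Y -> X = Y.
Proof.
move=> [x1 x2 x3 x4] [y1 y2 y3 y4].
have AXY : A *m X = A *m Y.
  by rewrite -[LHS]x3 -{1}y1 -mulmxA trmx_mul x3 y3 mulmxA x1.
have XYA : X *m A = Y *m A.
  by rewrite -[LHS]x4 -{1}y1 -(mulmxA A) mulmxA trmx_mul x4 y4 -mulmxA
    (mulmxA A) x1.
by rewrite -x2 -mulmxA AXY mulmxA XYA y2.
Qed.

Lemma gram_unitmx r p (C : 'M[R]_(r, p)) : row_free C -> C *m C^T \in unitmx.
Proof.
move=> fC; rewrite -row_free_unit -kermx_eq0; apply/rowV0P => v /sub_kermxP.
rewrite mulmxA => /(congr1 (mulmx^~ v^T)); rewrite mul0mx -mulmxA -trmx_mul.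
move=> vC; suff /eqP : v *m C = 0 by rewrite mulmx_free_eq0// => /eqP.
move: (v *m C) vC => {C fC v} w /matrixP /(_ 0 0); rewrite !mxE => /eqP w0.
apply/rowP => i; rewrite mxE; move: w0.
rewrite psumr_eq0 => [|j _]; last by rewrite mxE -expr2 sqr_ge0.
by move=> /allP /(_ i (mem_index_enum i)); rewrite mxE mulf_eq0 orbb => /eqP.
Qed.

Lemma penrose_full_rank r (D : 'M[R]_(m, r)) (C : 'M[R]_(r, n)) :
    row_free D^T -> row_free C ->
  penrose (D *m C)
    (C^T *m invmx (C *m C^T) *m (invmx (D^T *m D) *m D^T)).
Proof.
move=> /gram_unitmx; rewrite trmxK => uD /gram_unitmx uC.
set VC := invmx (C *m C^T); set VD := invmx (D^T *m D).
have vC : VC^T = VC by rewrite /VC trmx_inv trmx_mul trmxK.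
have vD : VD^T = VD by rewrite /VD trmx_inv trmx_mul trmxK.
set X := C^T *m VC *m (VD *m D^T).
have AX : D *m C *m X = D *m (VD *m D^T).
  by rewrite /X -mulmxA 2!(mulmxA C) (mulmxV uC) mul1mx.
have XA : X *m (D *m C) = C^T *m VC *m C.
  by rewrite /X -mulmxA (mulmxA _ D) -(mulmxA VD) (mulVmx uD) mul1mx.
split.
- by rewrite AX mulmxA -(mulmxA D) -(mulmxA VD) (mulVmx uD) mulmx1.
- by rewrite XA /X -!mulmxA (mulmxA C) (mulmxA (C *m _)) (mulmxV uC) mul1mx.
- by rewrite AX !trmx_mul trmxK vD mulmxA.
- by rewrite XA !trmx_mul trmxK vC mulmxA.
Qed.

Lemma penrose_pinv A : penrose A (pinv A).
Proof.
rewrite /pinv; case: xgetP => // none; exfalso.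
have := @penrose_full_rank _ (col_base A) (row_base A).
rewrite mulmx_base => /(_ _ (row_base_free A)) H; apply: (none _ (H _)).
by rewrite /row_free mxrank_tr; exact: col_base_full.
Qed.

End pseudo_inverse.

Section multivariate_normal.
Context (R : realType).

(* N(m, v), with v the variance, including the degenerate case v = 0, for
   which [normal_prob m 0] is not the Dirac mass at m. *)
Definition normal_law (m v : R) : set (measurableTypeR R) -> \bar R :=
  if v == 0 then dirac (m : measurableTypeR R)
  else normal_prob m (Num.sqrt v).

(* X ~ N(m, A) on R^n, possibly degenerate: A is a covariance matrix (symmetric
   and positive semidefinite), and every linear combination t^T X is normal
   with mean t^T m and variance t^T A t. *)
Definition mvnormal d (T : measurableType d) (P : probability T R) (n : nat)
    (X : T -> 'cV[R]_n) (m : 'cV[R]_n) (A : 'M[R]_n) : Prop :=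
  [/\ A^T = A,
      forall t : 'cV[R]_n, 0 <= (t^T *m A *m t) 0 0,
      forall i, measurable_fun [set: T] (fun w => X w i 0)
    & forall t : 'cV[R]_n, forall U : set (measurableTypeR R), measurable U ->
        pushforward P (fun w => (t^T *m X w) 0 0 : measurableTypeR R) U =
        normal_law ((t^T *m m) 0 0) ((t^T *m A *m t) 0 0) U].

End multivariate_normal.

Section bochner.
Context d (T : measurableType d) (R : realType) (B : normedModType R).
Context (P : probability T R).

Definition vsimple (s : T -> B) :=
  finite_set (range s) /\ forall x, measurable (s @^-1` [set x]).

Definition vsimple_integral (s : T -> B) : B :=
  \sum_(x \in range s) fine (P (s @^-1` [set x])) *: x.

Definition is_bochner_integral (f : T -> B) (x : B) :=
  exists s : (T -> B)^nat,
    [/\ forall k, vsimple (s k),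
        {ae P, forall w, s k w @[k --> \oo] --> f w},
        (\int[P]_w `|f w - s k w|%:E)%E @[k --> \oo] --> 0%E
      & vsimple_integral (s k) @[k --> \oo] --> x].

(* 0 when [f] is not Bochner integrable; 0 is in the range of [Gamma] below in
   any case, so this convention does not enlarge that range. *)
Definition bochner_integral (f : T -> B) : B :=
  xget 0 [set x | is_bochner_integral f x].

End bochner.

Section kernel_based_measure.
Context (R : realType) (B : completeNormedModType R).
Implicit Types (P : probability (borelType B) R) (mu : B)
  (K : dual B -> dual B -> R).

(* The random variable S_L : omega |-> L omega. *)
Definition Sfun (L : dual B) : borelType B -> R := fun w => L w.

Definition dual_vec n (Ln : 'I_n -> dual B) (w : B) : 'cV[R]_n :=
  \col_j (Ln j w).

Definition kernel_mx K n (Ln : 'I_n -> dual B) : 'M[R]_n :=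
  \matrix_(j, k) K (Ln j) (Ln k).

Definition kernel_based P mu K :=
  forall n (Ln : 'I_n -> dual B),
    mvnormal P (fun w => \col_j (Sfun (Ln j) w)) (dual_vec Ln mu)
      (kernel_mx K Ln).

Definition span_S : set (borelType B -> R) :=
  [set h | exists m (c : 'I_m -> R) (L : 'I_m -> dual B),
     h = fun w => \sum_(i < m) c i * Sfun (L i) w].

(* Elements of L_2(P) are represented by square-integrable functions;
   [H_S P] is stable under P-a.e. equality. *)
Definition H_S P : set (borelType B -> R) :=
  [set V | V \in Lfun P 2%:E /\
     forall e : R, 0 < e ->
       exists2 h, span_S h & ('N[P]_2%:E[EFin \o (V \- h)%R] < e%:E)%E].

Definition Gamma P (V : borelType B -> R) : B :=
  bochner_integral P (fun w => V w *: (w : B)).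

Definition kernel_vec K n (Ln : 'I_n -> dual B) (L : dual B) : 'cV[R]_n :=
  \col_j K L (Ln j).

Definition beta_vec K n (Ln : 'I_n -> dual B) (L : dual B) : 'cV[R]_n :=
  pinv (kernel_mx K Ln) *m kernel_vec K Ln L.

Definition sigma_cond K n (Ln : 'I_n -> dual B) (L : dual B) : R :=
  Num.sqrt (K L L - ((kernel_vec K Ln L)^T *m pinv (kernel_mx K Ln)
                     *m kernel_vec K Ln L) 0 0).

Definition interpolant mu K n (Ln : 'I_n -> dual B) (fn : 'cV[R]_n)
    (L : dual B) : R :=
  L mu + ((kernel_vec K Ln L)^T *m pinv (kernel_mx K Ln)
          *m (fn - dual_vec Ln mu)) 0 0.

End kernel_based_measure.

(* Main.v *)
Require Import Defs.
From HB Require Import structures.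
From mathcomp Require Import all_boot all_order all_algebra.
From mathcomp Require Import all_classical all_reals all_analysis.
From mathcomp Require Import measurable_realfun ring lra.

Set Implicit Arguments.
Unset Strict Implicit.
Unset Printing Implicit Defensive.

Import Order.TTheory GRing.Theory Num.Theory.
Import numFieldNormedType.Exports.

Local Open Scope classical_set_scope.
Local Open Scope ring_scope.

(** Let M := L - beta(L)^T L_n, again a continuous functional. Because the
    pseudo-inverse of the symmetric matrix A is symmetric, the interpolation
    error is exactly M u - M mu, so only |M u| has to be bounded.

    Write u = int V(w) w P(dw) with V square-integrable. A continuous functional
    can be moved inside a Bochner integral, at least as an inequality
    ([bochner_norm_le]), and Hoelder's inequality gives
    |M u| <= ||V||_2 ||M||_2 ([dual_Gamma_le]).

    Under P the variable M is normal. Its mean is M mu, and the Penrose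
    identities give it the variance sigma^2 ([residual_law]). Hence
    ||M||_2 = sqrt (sigma^2 + (M mu)^2), which is at most a constant times
    sigma + |M mu|. The constants may depend on anything but L and L_n, so the
    crude bound ||M||_2 <= 4 (sigma + |M mu|) of [normal_law_moment2_le] is
    enough, and the exact second moment of a normal law is never computed.
    With N := ||V||_2 this yields C1 = 4 N and C2 = 4 N + 1. *)

(** * Symmetry of the pseudo-inverse *)

Section pseudo_inverse.
Context (R : realType).

(** The transpose of a Penrose inverse of [A] is a Penrose inverse of [A^T], so
    this is the uniqueness of Penrose inverses. *)
Lemma pinv_sym n (A : 'M[R]_n) : A^T = A -> (Defs.pinv A)^T = Defs.pinv A.
Proof.
move=> sA; apply: (@penrose_unique R n n A); last exact: penrose_pinv.
move: (Defs.pinv A) (penrose_pinv A) => X [p1 p2 p3 p4]; split.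
- by apply: trmx_inj; rewrite !trmx_mul trmxK sA mulmxA.
- by apply: trmx_inj; rewrite !trmx_mul trmxK sA mulmxA.
- by rewrite trmx_mul trmxK sA -p4 trmx_mul sA.
- by rewrite trmx_mul trmxK sA -p3 trmx_mul sA.
Qed.
End pseudo_inverse.

(** * Continuous linear functionals *)

Section continuous_functionals.
Context (R : realType).

Lemma dual_residual (B : completeNormedModType R) n (L : dual B) (Ln : 'I_n -> dual B) (c : 'cV[R]_n) :
  exists M : dual B, forall w, M w = L w - (c^T *m dual_vec Ln w) 0 0.
Proof.
pose f (w : B) : R^o := L w - \sum_i c i 0 * Ln i w.
have flin : linear f.
  move=> a x y; rewrite /f linearP /=.
  under eq_bigr do rewrite linearP /= mulrDr.
  rewrite big_split /= scalerBr opprD addrACA scaler_sumr.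
  by congr (_ - _ + _); apply: eq_bigr => i _; rewrite mulrCA.
pose fL : {linear B -> R^o} := HB.pack f (GRing.isLinear.Build _ _ _ _ f flin).
have fc : continuous fL.
  move=> x; apply: cvgB; first exact: dual_continuous.
  apply: cvg_big => [|i _]; first exact: add_continuous.
  by apply: cvgM; [exact: cvg_cst|exact: dual_continuous].
exists (Dual fc) => w; rewrite /= /f mxE; congr (_ - _).
by apply: eq_bigr => i _; rewrite !mxE.
Qed.

Context (B : normedModType R).

Lemma dual_bounded (M : dual B) :
  exists2 c : R, 0 < c & forall x, `|M x| <= c * `|x|.
Proof.
have /linear_bounded_continuous/linear_boundedP := @dual_continuous _ _ M.
by move=> /pinfty_ex_gt0.
Qed.

Lemma dual_measurable (M : dual B) :
  measurable_fun [set: borelType B]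
    (M : borelType B -> measurableTypeR R).
Proof.
apply: (measurability _ (RGenOpens.measurableE R)).
move=> _ [_ [x [y ->]] <-]; rewrite setTI; apply: sub_sigma_algebra.
by move/continuousP: (@dual_continuous _ _ M); apply; exact: interval_open.
Qed.
End continuous_functionals.

(** * Second moments of normal laws *)

Section normal_moments.
Context (R : realType).
Local Notation lam := (@lebesgue_measure R).

(** The normal density agrees almost everywhere with the Radon-Nikodym
    derivative of the normal law, for which the change of variables is known. *)
Lemma integral_normal_probE (m s : R) (f : measurableTypeR R -> \bar R) :
  measurable_fun setT f -> (forall x, 0 <= f x)%E ->
  (\int[normal_prob m s]_x f x = \int[lam]_x (f x * (normal_pdf m s x)%:E))%E.
Proof.
move=> mf f0.
have dom := normal_prob_dominates m s.
pose g := Radon_Nikodym_SigmaFinite.f (normal_prob m s) lam.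
have gi : lam.-integrable setT g by exact: Radon_Nikodym_SigmaFinite.f_integrable.
have mp : measurable_fun setT (fun x => (normal_pdf m s x)%:E).
  by apply/measurable_EFinP; exact: measurable_normal_pdf.
rewrite -(@Radon_Nikodym_SigmaFinite.change_of_variables _ _ R (normal_prob m s) lam)//.
apply: ge0_ae_eq_integral => //.
- by apply: emeasurable_funM => //; exact: measurable_int gi.
- exact: emeasurable_funM.
- by move=> x _; rewrite mule_ge0// Radon_Nikodym_SigmaFinite.f_ge0.
- by move=> x _; rewrite mule_ge0// lee_fin normal_pdf_ge0.
- apply: ae_eqe_mul2l; apply: integral_ae_eq => // E _ mE.
  by rewrite -Radon_Nikodym_SigmaFinite.f_integral.
Qed.

(** With z := (x - m)^2 / (4 s^2), the Gaussian factor of deviation [s] is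
    exp(-z)^2, and that of deviation [sqrt 2 * s] is exp(-z). Since
    z exp(-z) <= 1, one of the two factors exp(-z) absorbs the polynomial
    factor 4 s^2 z, at the price of a wider Gaussian. The peaks of the two
    densities differ by a factor sqrt 2, here bounded by 2. *)
Lemma sqr_normal_pdf_le (m s x : R) : 0 < s ->
  (x - m) ^+ 2 * normal_pdf m s x <= 8 * s ^+ 2 * normal_pdf m (Num.sqrt 2 * s) x.
Proof.
move=> s0.
have r0 : 0 < Num.sqrt 2 * s by rewrite mulr_gt0 ?sqrtr_gt0.
rewrite !normal_pdfE ?gt_eqF// /normal_fun.
set z := (x - m) ^+ 2 / (4 * s ^+ 2).
have -> : - (x - m) ^+ 2 / ((Num.sqrt 2 * s) ^+ 2 *+ 2) = - z.
  by rewrite exprMn sqr_sqrtr// /z; field; rewrite gt_eqF.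
have -> : - (x - m) ^+ 2 / (s ^+ 2 *+ 2) = - z - z.
  by rewrite /z; field; rewrite gt_eqF.
have -> : (x - m) ^+ 2 = 4 * s ^+ 2 * z by rewrite /z; field; rewrite gt_eqF.
have zexp : z * expR (- z) <= 1.
  rewrite expRN ler_pdivrMr ?expR_gt0// mul1r.
  by rewrite (le_trans _ (expR_ge1Dx z))// lerDr.
have pk : normal_peak s <= 2 * normal_peak (Num.sqrt 2 * s).
  rewrite /normal_peak exprMn sqr_sqrtr//.
  have -> : 2 * s ^+ 2 * pi *+ 2 = 2 * (s ^+ 2 * pi *+ 2) by ring.
  have q0 : 0 < s ^+ 2 * pi *+ 2 by rewrite mulrn_wgt0// mulr_gt0 ?pi_gt0 ?exprn_gt0.
  rewrite (sqrtrM (s ^+ 2 * pi *+ 2))// invfM mulrA ler_peMl//.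
  rewrite ler_pdivlMr ?sqrtr_gt0// mul1r -(@ler_pXn2r _ 2)// ?nnegrE//.
  by rewrite sqr_sqrtr//; lra.
rewrite expRD.
have -> : 8 * s ^+ 2 * (normal_peak (Num.sqrt 2 * s) * expR (- z))
   = 4 * s ^+ 2 * (2 * normal_peak (Num.sqrt 2 * s)) * expR (- z) * 1 by ring.
have -> : 4 * s ^+ 2 * z * (normal_peak s * (expR (- z) * expR (- z)))
  = 4 * s ^+ 2 * normal_peak s * expR (- z) * (z * expR (- z)) by ring.
have s20 : 0 <= 4 * s ^+ 2 by rewrite mulr_ge0// sqr_ge0.
have p0 := normal_peak_ge0 s.
apply: ler_pM => //.
- by rewrite (mulr_ge0 (mulr_ge0 s20 p0)) ?expR_ge0.
- by rewrite mulr_ge0 ?expR_ge0// /z divr_ge0 ?sqr_ge0.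
- by rewrite ler_wpM2r ?expR_ge0// ler_wpM2l.
Qed.

(** The wider normal density has integral 1, so integrating
    [sqr_normal_pdf_le] bounds the variance without any computation of it. *)
Lemma normal_prob_variance_le (m s : R) : 0 < s ->
  (\int[normal_prob m s]_x ((x - m) ^+ 2)%:E <= (8 * s ^+ 2)%:E)%E.
Proof.
move=> s0.
have mq : measurable_fun setT (fun x : R => ((x - m) ^+ 2)%:E).
  by apply/measurable_EFinP; apply: measurable_funX; exact: measurable_funB.
rewrite integral_normal_probE//; last by move=> x; rewrite lee_fin sqr_ge0.
have mp r : measurable_fun setT (fun x => (normal_pdf m r x)%:E).
  by apply/measurable_EFinP; exact: measurable_normal_pdf.
rewrite -[leRHS]mule1 -(integral_normal_pdf m (Num.sqrt 2 * s)).
rewrite -ge0_integralZl//; first last.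
- by rewrite lee_fin mulr_ge0// sqr_ge0.
- by move=> x _; rewrite lee_fin normal_pdf_ge0.
- exact: mp.
apply: ge0_le_integral => //.
- by move=> x _; rewrite -EFinM lee_fin mulr_ge0 ?sqr_ge0 ?normal_pdf_ge0.
- by apply: emeasurable_funM; [exact: mq|exact: mp].
- by apply: emeasurable_funM; [exact: measurable_cst|exact: mp].
- by move=> x _; rewrite -!EFinM lee_fin; exact: sqr_normal_pdf_le.
Qed.

(** After transport to the real line, x^2 <= 2 (x - m)^2 + 2 m^2 reduces this
    to [normal_prob_variance_le]; when the variance vanishes the law is the
    Dirac mass at [m]. *)
Lemma normal_law_moment2_le d (T : measurableType d) (P : probability T R)
    (X : T -> measurableTypeR R) (m v : R) :
  measurable_fun [set: T] X -> 0 <= v ->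
  (forall U, measurable U -> pushforward P X U = normal_law m v U) ->
  (\int[P]_w ((X w) ^+ 2)%:E <= (16 * (Num.sqrt v + `|m|) ^+ 2)%:E)%E.
Proof.
move=> mX v0 lawX.
have mq (a : R) : measurable_fun setT (fun x : measurableTypeR R => ((x - a) ^+ 2)%:E).
  by apply/measurable_EFinP; apply: measurable_funX; exact: measurable_funB.
have mq0 : measurable_fun setT (fun x : measurableTypeR R => (x ^+ 2)%:E).
  by apply/measurable_EFinP; exact: measurable_funX.
rewrite -[leLHS]/(\int[P]_(w in X @^-1` setT) ((fun x => (x ^+ 2)%:E) \o X) w)%E.
rewrite -ge0_integral_pushforward//; last by move=> x _; rewrite lee_fin sqr_ge0.
have m2 : `|m| ^+ 2 = m ^+ 2 by rewrite real_normK ?num_real.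
have [v00|vN0] := eqVneq v 0.
  rewrite (eq_measure_integral (dirac (m : measurableTypeR R))); last first.
    by move=> U mU _; rewrite [LHS]lawX// /normal_law v00 eqxx.
  rewrite integral_dirac// diracT mul1e lee_fin v00 sqrtr0 add0r m2.
  by have := sqr_ge0 m; lra.
have s0 : 0 < Num.sqrt v by rewrite sqrtr_gt0 lt_neqAle eq_sym vN0.
rewrite (eq_measure_integral (normal_prob m (Num.sqrt v))); last first.
  by move=> U mU _; rewrite [LHS]lawX// /normal_law (negbTE vN0).
apply: (@le_trans _ _ (\int[normal_prob m (Num.sqrt v)]_x
    (2%:E * ((x - m) ^+ 2)%:E + (2 * m ^+ 2)%:E))%E).
  apply: ge0_le_integral => //.
  - by move=> x _; rewrite lee_fin sqr_ge0.
  - by apply: emeasurable_funD => //; apply: emeasurable_funM => //.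
  - move=> x _; rewrite -EFinM -EFinD lee_fin.
    by have := sqr_ge0 (x - 2 * m); nra.
rewrite ge0_integralD//; first last.
- by move=> x _; rewrite lee_fin mulr_ge0// sqr_ge0.
- by apply: emeasurable_funM => //.
- by move=> x _; rewrite mule_ge0// lee_fin sqr_ge0.
rewrite ge0_integralZl//; last by move=> x _; rewrite lee_fin sqr_ge0.
rewrite integral_cst// [X in (_ + _ * X)%E](_ : _ = 1%E) ?mule1; last first.
  exact: (@probability_setT _ _ _ (normal_prob m (Num.sqrt v))).
apply: (@le_trans _ _ (2%:E * (8 * Num.sqrt v ^+ 2)%:E + (2 * m ^+ 2)%:E)%E).
  by rewrite leeD2r// lee_pmul2l//; exact: normal_prob_variance_le.
rewrite -EFinM -EFinD lee_fin -m2.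
have := normr_ge0 m; have := ltW s0; move: (Num.sqrt v) (`|m|) => a b.
by move=> a0 b0; have := mulr_ge0 a0 b0; nra.
Qed.
End normal_moments.

(** * Functionals of Bochner integrals *)

Section bochner.
Context d (T : measurableType d) (R : realType) (P : probability T R).

(** The integral of a nonnegative function is a supremum over the simple
    functions below it, hence monotone even on non-measurable functions. This
    matters for [w |-> `|f w - s k w|]: when [B] is not separable, this
    function need not be measurable. *)
Lemma ge0_le_integralT (f g : T -> \bar R) :
  (forall x, 0 <= f x)%E -> (forall x, f x <= g x)%E ->
  (\int[P]_x f x <= \int[P]_x g x)%E.
Proof.
move=> f0 fg; have g0 x : (0 <= g x)%E by exact: le_trans (f0 x) (fg x).
rewrite !ge0_integralTE//; apply: ereal_sup_le => _ [h hf <-].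
by exists h => // x; exact: le_trans (hf x) (fg x).
Qed.

Context (B : normedModType R).

Lemma vsimple_normE (M : B -> R) (s : T -> B) w : finite_set (range s) ->
  `|M (s w)| = \sum_(x \in range s) `|M x| * \1_(s @^-1` [set x]) w.
Proof.
move=> fs; rewrite (fsbigD1 (s w)) //=; last by exists w.
  rewrite indicE mem_set// mulr1 fsbig1 ?addr0// => x [_ /= xsw].
  by rewrite indicE memNset ?mulr0// => /= /esym.
Qed.

Lemma vsimple_measurable (M : B -> R) (s : T -> B) : vsimple s ->
  measurable_fun [set: T] (fun w => M (s w)).
Proof.
move=> [fs ms] _ Y mY; rewrite setTI.
have -> : (fun w => M (s w)) @^-1` Y =
    \bigcup_(x in range s `&` M @^-1` Y) (s @^-1` [set x]).
  apply/seteqP; split => [w /= Yw|w [x [_ /= Yx] /= ->]//].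
  by exists (s w) => //; split => //; exists w.
apply: fin_bigcup_measurable => [|x _]; last exact: ms.
exact: finite_setIl.
Qed.

Lemma vsimple_integral_le (M : {linear B -> R^o}) (s : T -> B) : vsimple s ->
  (`|M (vsimple_integral P s)|%:E <= \int[P]_w (`|M (s w)|)%:E)%E.
Proof.
move=> [fs ms].
under eq_integral => w _ do rewrite (vsimple_normE M w fs) -fsumEFin//.
rewrite ge0_integral_fsum//; last first.
  by move=> x; apply/measurable_EFinP; exact: measurable_funM.
apply: (@le_trans _ _ (\sum_(x \in range s) (`|M x| * fine (P (s @^-1` [set x])))%:E)%E).
  rewrite fsumEFin// lee_fin /vsimple_integral !fsbig_finite//= linear_sum.
  apply: le_trans (ler_norm_sum _ _ _) _; apply: ler_sum => x _.
  by rewrite linearZ /= normrM mulrC [X in _ * X]ger0_norm// fine_ge0.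
apply: lee_fsum => [|x _] //=; rewrite EFinM fineK ?fin_num_measure//.
rewrite (eq_integral (fun w => `|M x|%:E * (\1_(s @^-1` [set x]) w)%:E)%E)//.
rewrite ge0_integralZl//; last first.
- by apply/measurable_EFinP; exact: measurable_indic.
by rewrite integral_indic// setIT.
Qed.

(** By [vsimple_integral_le] and the triangle inequality,
    |M (int s_k)| <= int |M f| + int |M (f - s_k)|, where the last term is at
    most c int |f - s_k| and so tends to 0. All functions that are added or
    scaled under the integral have the form |M _|, so that they are
    measurable. *)
Lemma bochner_norm_le (M : {linear B -> R^o}) (c : R) (f : T -> B) (x : B) :
  0 < c -> (forall y, `|M y| <= c * `|y|) -> continuous M ->
  measurable_fun [set: T] (fun w => M (f w) : R) ->
  is_bochner_integral P f x ->
  (`|M x|%:E <= \int[P]_w `|M (f w)|%:E)%E.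
Proof.
move=> c0 Mc cM mMf [s [vs _ sf sx]].
have Msx : (`|M (vsimple_integral P (s k))|%:E @[k --> \oo] --> `|M x|%:E)%E.
  apply: cvg_EFin; first by apply: nearW.
  by apply: cvg_norm; apply: continuous_cvg => //; exact: cM.
have bd k : (`|M (vsimple_integral P (s k))|%:E <=
    \int[P]_w `|M (f w)|%:E + c%:E * \int[P]_w `|f w - s k w|%:E)%E.
  have mMs := vsimple_measurable M (vs k).
  have mMf' : measurable_fun setT (fun w => `|M (f w)|%:E).
    by apply/measurable_EFinP; exact: measurableT_comp.
  have mMd : measurable_fun setT (fun w => `|M (f w - s k w)|%:E).
    apply/measurable_EFinP; apply: measurableT_comp => //.
    under eq_fun do rewrite linearB.
    exact: measurable_funB.
  apply: le_trans (vsimple_integral_le _ (vs k)) _.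
  apply: (@le_trans _ _ (\int[P]_w (`|M (f w)|%:E + `|M (f w - s k w)|%:E))%E).
    apply: ge0_le_integralT => w; first by rewrite lee_fin.
    rewrite -EFinD lee_fin linearB /= -{1}(subKr (M (f w)) (M (s k w))).
    exact: ler_normB.
  rewrite ge0_integralD//; apply: leeD2l.
  (* [c] is moved to the measurable side, where it passes under the integral *)
  rewrite -lee_pdivrMl// -ge0_integralZl//; last by rewrite lee_fin invr_ge0 ltW.
  apply: ge0_le_integralT => w; first by rewrite mule_ge0// lee_fin invr_ge0 ltW.
  by rewrite -EFinM lee_fin ler_pdivrMl.
have cv : ((\int[P]_w `|M (f w)|%:E + c%:E * \int[P]_w `|f w - s k w|%:E)%E
    @[k --> \oo] --> (\int[P]_w `|M (f w)|%:E + c%:E * 0)%E).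
  apply: cvgeD; [|exact: cvg_cst|exact: cvgeZl].
  by rewrite mule0 fin_num_adde_defl.
rewrite mule0 adde0 in cv.
by apply: lee_cvg_to cv _; [exact: Msx|exact: nearW].
Qed.
End bochner.

(** * The L2 norm *)

Section L2_norm.
Context d (T : measurableType d) (R : realType) (P : probability T R).

Lemma L2norm_le (X : T -> R) (a : R) : 0 <= a ->
  (\int[P]_w ((X w) ^+ 2)%:E <= (a ^+ 2)%:E)%E -> ('N[P]_2%:E[EFin \o X] <= a%:E)%E.
Proof.
move=> a0 Xa; rewrite unlock /=.
under eq_integral => w _ do rewrite /= powR_mulrn// -normrX ger0_norm ?sqr_ge0//.
have : ((\int[P]_w ((X w) ^+ 2)%:E) `^ 2^-1 <= ((a ^+ 2)%:E) `^ 2^-1)%E.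
  apply: gt0_ler_poweR => //; rewrite ?invr_ge0// in_itv/= leey andbT.
  - by apply: integral_ge0 => w _; rewrite lee_fin sqr_ge0.
  - by rewrite lee_fin sqr_ge0.
move=> /le_trans; apply.
by rewrite poweR_EFin powR12_sqrt ?sqr_ge0// sqrtr_sqr ger0_norm.
Qed.
End L2_norm.

(** * The residual functional under a kernel-based measure *)

Section kernel_based_measure.
Context (R : realType) (B : completeNormedModType R).
Context (P : probability (borelType B) R) (mu : B) (K : dual B -> dual B -> R).
Hypothesis hP : kernel_based P mu K.

(** [M] is the combination of L, L_1, ..., L_n with coefficients 1 and -beta,
    so it is normal. Its variance K(L,L) - 2 b^T X b + b^T X A X b, with X the
    pseudo-inverse of A, collapses to sigma^2 through X A X = X. *)
Lemma residual_law n (Ln : 'I_n -> dual B) (L M : dual B) :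
  (forall w, M w = L w - ((beta_vec K Ln L)^T *m dual_vec Ln w) 0 0) ->
  exists v : R, [/\ 0 <= v, Num.sqrt v = sigma_cond K Ln L &
    forall U : set (measurableTypeR R), measurable U ->
      pushforward P (M : borelType B -> measurableTypeR R) U =
      normal_law (M mu) v U].
Proof.
move=> HM; set b := kernel_vec K Ln L; set A := kernel_mx K Ln; set X := Defs.pinv A.
have sX : X^T = X by apply: pinv_sym; have [] := hP Ln.
have [_ XAX _ _] := penrose_pinv A.
pose LL (i : 'I_(1 + n)) := match fintype.split i with inl _ => L | inr j => Ln j end.
have LLl i : LL (lshift n i) = L by rewrite /LL (unsplitK (inl i)).
have LLr j : LL (rshift 1 j) = Ln j by rewrite /LL (unsplitK (inr j)).
have [sLL pLL _ lawLL] := hP LL.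
have KLL : kernel_mx K LL = block_mx (K L L)%:M b^T b A.
  apply/matrixP => i j.
  case: (split_ordP i) => i' ->; case: (split_ordP j) => j' ->;
    rewrite ?(block_mxEul, block_mxEur, block_mxEdl, block_mxEdr) !mxE ?LLl ?LLr//.
    by rewrite !ord1.
  (* lower left block: K is symmetric because covariance matrices are *)
  move/matrixP: sLL => /(_ (lshift n j') (rshift 1 i')).
  by rewrite !mxE LLl LLr.
pose t : 'cV[R]_(1 + n) := col_mx 1%:M (- beta_vec K Ln L).
have MLL w : (t^T *m dual_vec LL w) 0 0 = M w.
  rewrite (_ : dual_vec LL w = col_mx (L w)%:M (dual_vec Ln w)); last first.
    apply/matrixP => i j; case: (split_ordP i) => i' ->;
      rewrite ?(col_mxEu, col_mxEd) !mxE ?LLl ?LLr//.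
    by rewrite !ord1.
  rewrite /t tr_col_mx mul_row_col trmx1 mul1mx linearN mulNmx HM.
  by rewrite mxE [X in X + _]mxE eqxx mulr1n [X in _ + X]mxE.
have var : (t^T *m kernel_mx K LL *m t) 0 0 = K L L - (b^T *m X *m b) 0 0.
  rewrite KLL /t tr_col_mx mul_row_block mul_row_col trmx1 !mul1mx mulmx1.
  rewrite linearN /= /beta_vec -/A -/X -/b trmx_mul sX !mulNmx !mulmxN.
  rewrite mulmxDl mulNmx opprD opprK -!mulmxA.
  rewrite (mulmxA X A) (mulmxA (X *m A)) XAX addNr addr0.
  by rewrite mxE [X in X + _]mxE eqxx mulr1n [X in _ + X]mxE.
exists (K L L - (b^T *m X *m b) 0 0); split => //; first by rewrite -var.
move=> U mU; rewrite -var -MLL -lawLL//; congr (P (_ @^-1` U)).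
by apply/funext => w; rewrite -MLL.
Qed.

(** If the Bochner integral does not exist, [Gamma P V] is 0 by convention and
    the bound is trivial. *)
Lemma dual_Gamma_le (M : dual B) (V : borelType B -> R) : V \in Lfun P 2%:E ->
  (`|M (Gamma P V)|%:E <=
   'N[P]_2%:E[EFin \o V] * 'N[P]_2%:E[EFin \o (M : borelType B -> R)])%E.
Proof.
move=> /andP[/= mV _]; rewrite inE /= in mV.
have mM := dual_measurable M.
rewrite /Gamma /bochner_integral; case: xgetP => [x _ /= ix|_]; last first.
  by rewrite linear0 normr0 mule_ge0// Lnorm_ge0.
have [c c0 Mc] := dual_bounded M.
have MV : (fun w : borelType B => M (V w *: (w : B)) : R) = (V \* (M : borelType B -> R)).
  by apply/funext => w /=; rewrite linearZ.
apply: le_trans (bochner_norm_le c0 Mc (@dual_continuous _ _ M) _ ix) _.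
  by rewrite MV; exact: measurable_funM.
apply: le_trans (hoelder P mV mM _ _ _) => //; last first.
  by lra.
rewrite Lnorm1; apply: ge0_le_integralT => // w.
by rewrite /= linearZ.
Qed.

End kernel_based_measure.

Theorem theorem3p14 (R : realType) (B : completeNormedModType R)
  (P : probability (borelType B) R) (mu : B) (K : dual B -> dual B -> R)
  (hP : kernel_based P mu K) (u : B) (hu : (Gamma P @` H_S P) u) :
  exists C1 C2 : R, [/\ 0 <= C1, 0 <= C2 &
    forall (n : nat) (Ln : 'I_n -> dual B), kernel_mx K Ln != 0 ->
    forall L : dual B,
      `|L u - interpolant mu K Ln (dual_vec Ln u) L|
      <= C1 * sigma_cond K Ln L
         + C2 * `|L mu - ((beta_vec K Ln L)^T *m dual_vec Ln mu) 0 0| ].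
Proof.
have [V [V2 _] <-] := hu.
pose N := fine ('N[P]_2%:E[EFin \o V]).
have N0 : 0 <= N by rewrite fine_ge0// Lnorm_ge0.
have NE : ('N[P]_2%:E[EFin \o V] = N%:E)%E.
  by rewrite fineK// ge0_fin_numE ?Lnorm_ge0//; case/andP: V2 => _; rewrite inE.
exists (4 * N), (4 * N + 1); split; [lra|lra|].
move=> n Ln _ L.
have [M ME] := dual_residual L Ln (beta_vec K Ln L).
have [v [v0 vE law]] := residual_law hP ME.
(* the interpolation error is the residual functional at [u - mu] *)
have -> : L (Gamma P V) - interpolant mu K Ln (dual_vec Ln (Gamma P V)) L
    = M (Gamma P V) - M mu.
  rewrite /interpolant !ME /beta_vec trmx_mul pinv_sym; last by have [] := hP n Ln.
  have sub00 (x y : 'M[R]_1) : (x - y) 0 0 = x 0 0 - y 0 0 by rewrite !mxE.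
  by rewrite mulmxBr sub00; ring.
rewrite -ME -vE.
set a := Num.sqrt v + `|M mu|.
have a0 : 0 <= a by rewrite addr_ge0// sqrtr_ge0.
have Ma : ('N[P]_2%:E[EFin \o (M : borelType B -> R)] <= (4 * a)%:E)%E.
  apply: L2norm_le; first by rewrite mulr_ge0.
  rewrite exprMn (_ : 4 ^+ 2 = 16); last by ring.
  by apply: normal_law_moment2_le => //; exact: dual_measurable.
have : `|M (Gamma P V)| <= N * (4 * a).
  rewrite -lee_fin EFinM -NE; apply: le_trans (dual_Gamma_le _ V2) _.
  by apply: lee_wpmul2l => //; exact: Lnorm_ge0.
have := ler_normB (M (Gamma P V)) (M mu); rewrite /a; nra.
Qed.
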